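(* Let $d,m\ge1$ be integers, $X=\mathbf{R}^d$ and $Y=\mathbf{R}^m$. Let $\mathscr{A}=\{A^\nu:\nu<\kappa\}$ be a nonempty set of infinite matrices $A^\nu=(A^\nu_{n,k}:n,k\in\omega)$ of linear operators in $\mathcal{B}(X,Y)$, and fix $T\in\mathcal{B}(X,Y)$. Represent each $A^\nu_{n,k}$ by the real matrix $[a^\nu_{n,k}(i,j):1\le i\le m,1\le j\le d]$ and $T$ by the real matrix $[t(i,j):1\le i\le m,1\le j\le d]$. Let $\mathcal{I},\mathcal{J}$ be ideals on $\omega$ such that $\mathcal{J}$ is countably generated. Then $\mathscr{A}$ is $(\mathcal{I},\mathcal{J})$-regular with respect to $T$ if and only if all of the following hold: (D1) $\sup_n\sum_k\sum_{i,j}|a^\nu_{n,k}(i,j)|<\infty$ for each $\nu$; (D2) $\sup_\nu\sup_{n\in J}\sum_k\sum_{i,j}|a^\nu_{n,k}(i,j)|<\infty$ for some $J\in\mathcal{J}^\star$; (D3) $\mathcal{J}\text{-}\lim_n\sum_ka^\nu_{n,k}(i,j)=t(i,j)$ uniformly on $\nu$, for all $1\le i\le m$ and $1\le j\le d$; (D4) $\mathcal{J}\text{-}\lim_n\sum_{k\in E}a^\nu_{n,k}(i,j)=0$ uniformly on $\nu$, for all $1\le i\le m$, $1\le j\le d$, and $E\in\mathcal{I}$.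
   Context: $\omega=\{0,1,2,\ldots\}$. $\mathcal{B}(X,Y)$ is the space of (bounded) linear operators $X\to Y$. The index $\nu$ ranges over all $\nu<\kappa$, where $\kappa=|\mathscr{A}|$ is an arbitrary nonzero cardinal. An ideal on $\omega$ is a family $\mathcal{I}$ of subsets of $\omega$ closed under finite unions and subsets; it is always assumed that $\omega\notin\mathcal{I}$ and that $\mathcal{I}$ contains all finite subsets of $\omega$. $\mathcal{I}^\star:=\{\omega\setminus S:S\in\mathcal{I}\}$. $\mathcal{I}$ is countably generated if there is a sequence $(S_n)_{n\in\omega}$ in $\mathcal{I}$ such that for all $S\subseteq\omega$: $S\in\mathcal{I}$ iff $S\subseteq\bigcup_{n\in F}S_n$ for some finite $F\subseteq\omega$. A sequence $(x_n)$ is $\mathcal{I}$-convergent to $\eta$ ($\mathcal{I}\text{-}\lim\bm{x}=\eta$) if $\{n:x_n\notin U\}\in\mathcal{I}$ for every neighborhood $U$ of $\eta$. A statement ''$\mathcal{J}\text{-}\lim_n y^\nu_n=\eta$ uniformly on $\nu$'' means: for every neighborhood $U$ of $\eta$ there is $S\in\mathcal{J}^\star$ with $y^\nu_n\in U$ for all $n\in S$ and all $\nu<\kappa$. For a matrix $A=(A_{n,k})$ of linear operators from $X$ to $Y$, $\mathrm{dom}(A)$ is the set of $\bm{x}=(x_k)\in X^\omega$ such that $\sum_kA_{n,k}x_k$ converges in $Y$ for every $n$; then $A_n\bm{x}:=\sum_kA_{n,k}x_k$ and $A\bm{x}:=(A_n\bm{x}:n\in\omega)$. $c^b(X,\mathcal{I})$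 is the space of bounded $\mathcal{I}$-convergent sequences in $X$. $(\mathcal{C},\mathcal{D})$, for $\mathcal{C}\subseteq X^\omega$, $\mathcal{D}\subseteq Y^\omega$, is the set of matrices $A$ with $\mathcal{C}\subseteq\mathrm{dom}(A)$ and $A\bm{x}\in\mathcal{D}$ for all $\bm{x}\in\mathcal{C}$. $\mathscr{A}$ is $(\mathcal{I},\mathcal{J})$-regular with respect to $T$ if $A^\nu\in(c^b(X,\mathcal{I}),c^b(Y,\mathcal{J}))$ for all $\nu$ and, for all $\bm{x}\in c^b(X,\mathcal{I})$, $\mathcal{J}\text{-}\lim A^\nu\bm{x}=T(\mathcal{I}\text{-}\lim\bm{x})$ uniformly on $\nu$. *)

(* Defs.v *)
From mathcomp Require Export all_boot all_order all_algebra.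
From mathcomp Require Export all_classical all_reals all_analysis.
Export Order.TTheory GRing.Theory Num.Theory.
Export numFieldNormedType.Exports.

Set Implicit Arguments.
Unset Strict Implicit.
Unset Printing Implicit Defensive.

Local Open Scope classical_set_scope.
Local Open Scope ring_scope.

(* Ideals are always proper and contain all finite sets. *)
Record is_ideal (I : set (set nat)) : Prop := IsIdeal {
  idealU : forall S S', I S -> I S' -> I (S `|` S');
  idealS : forall S S', S' `<=` S -> I S -> I S';
  ideal_finite : forall S, finite_set S -> I S;
  ideal_proper : ~ I [set: nat] }.

Definition ideal_dual (I : set (set nat)) : set (set nat) :=
  [set ~` S | S in I].

Definition countably_generated (I : set (set nat)) : Prop :=
  exists2 S : nat -> set nat, (forall n, I (S n)) &
    forall B : set nat,
      I B <-> exists2 F : set nat, finite_set F & B `<=` \bigcup_(n in F) S n.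

Definition ideal_cvg (I : set (set nat)) (X : topologicalType)
    (x : nat -> X) (eta : X) : Prop :=
  forall U : set X, nbhs eta U -> I [set n | ~ U (x n)].

(* "I-lim_n y nu n = eta uniformly on nu", for nu ranging over the set N. *)
Definition ideal_ucvg (I : set (set nat)) (V : Type) (N : set V)
    (X : topologicalType) (y : V -> nat -> X) (eta : X) : Prop :=
  forall U : set X, nbhs eta U ->
    exists2 S, ideal_dual I S & forall n nu, S n -> N nu -> U (y nu n).

Section operators.
Variables (R : realType) (X Y : normedModType R).

Definition bounded_op : set {linear X -> Y} :=
  [set f | exists M : R, forall x : X, `|f x| <= M * `|x|].

Definition op_matrix : Type := nat -> nat -> {linear X -> Y}.

Definition op_dom (A : op_matrix) : set (nat -> X) :=
  [set x | forall n, cvgn (series (fun k => A n k (x k)))].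

(* meaningful only when x belongs to op_dom A *)
Definition op_apply (A : op_matrix) (x : nat -> X) : nat -> Y :=
  fun n => limn (series (fun k => A n k (x k))).

Definition matrix_class (C : set (nat -> X)) (D : set (nat -> Y)) :
    set op_matrix :=
  [set A | C `<=` op_dom A /\ forall x, C x -> D (op_apply A x)].

End operators.

Definition cb (R : realType) (X : normedModType R) (I : set (set nat)) :
    set (nat -> X) :=
  [set x | bounded_fun x /\ exists eta : X, ideal_cvg I x eta].
Arguments cb {R} X I.

Definition regular (R : realType) (X Y : normedModType R)
    (I J : set (set nat)) (AA : set (op_matrix X Y)) (T : {linear X -> Y}) :
    Prop :=
  AA `<=` matrix_class (cb X I) (cb Y J) /\
  forall x, cb X I x -> forall eta, ideal_cvg I x eta ->
    ideal_ucvg J AA (fun A n => op_apply A x n) (T eta).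

(* Vectors are columns, so that the entry (i, j) of the representing matrix is
   the i-th coordinate of the image of the j-th basis vector. *)
Definition opmx (R : realType) (d m : nat)
    (f : {linear 'cV[R]_d -> 'cV[R]_m}) : 'M[R]_(m, d) :=
  \matrix_(i, j) f (delta_mx j 0) i 0.

Lemma opmxE (R : realType) (d m : nat) (f : {linear 'cV[R]_d -> 'cV[R]_m})
    (x : 'cV[R]_d) : f x = opmx f *m x.
Proof.
rewrite [in LHS](matrix_sum_delta x) linear_sum /=.
apply/matrixP => i k; rewrite (ord1 k) summxE mxE.
by apply: eq_bigr => j _; rewrite big_ord1 linearZ /= !mxE mulrC.
Qed.

(* \sum_k \sum_(i, j) |a_(n, k)(i, j)|, in [0, +oo] *)
Definition abs_row_sum (R : realType) (d m : nat)
    (A : op_matrix 'cV[R]_d 'cV[R]_m) (n : nat) : \bar R :=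
  (\sum_(0 <= k <oo) (\sum_(i < m) \sum_(j < d) `|opmx (A n k) i j|)%:E)%E.

(* Main.v *)
(* Necessity of (D1) and (D2) rests on a gliding-hump form of the uniform
   boundedness principle for functionals on c_0, all of whose elements are
   bounded and I-convergent.  For (D2), write J as generated by (S_q): if no
   set of J^* works, choose nu_p and n_p outside S_0, ..., S_(p-1) so that the
   row n_p of A^(nu_p) has l1 norm at least p.  Uniform J-convergence to
   T 0 = 0 makes these rows pointwise bounded on c_0, a contradiction.
   (D3) and (D4) come from testing on constant sequences and on indicators of
   sets of I.

   For sufficiency, (D2) makes the rows a family of functionals bounded in sup
   norm, and a bounded sequence that I-converges to 0 is a uniform limit of
   combinations of indicators of sets of I, to which (D4) applies; (D3) handles
   the constant part. *)

Require Import Defs.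
From mathcomp Require Import ring lra.

Set Implicit Arguments.
Unset Strict Implicit.
Unset Printing Implicit Defensive.

Local Open Scope classical_set_scope.
Local Open Scope ring_scope.

(** * The gliding hump for finite rows *)

(** The intervals of centre [y n] and radius [r n] decrease, so the supremum of their left endpoints
    lies in all of them. *)
Lemma nested_intervals_pt (R : realType) (y : nat -> R) (r : nat -> R) :
  (forall n, `|y n.+1 - y n| <= r n - r n.+1) -> (forall n, 0 <= r n) ->
  exists x, forall n, `|x - y n| <= r n.
Proof.
move=> yr r0.
have incr (n k : nat) : y n - r n <= y (n + k)%N - r (n + k)%N.
  elim: k => [|k IH]; first by rewrite addn0.
  rewrite addnS; apply: le_trans IH _.
  by have := yr (n + k)%N; rewrite ler_norml => /andP[]; lra.
have decr (n k : nat) : y (n + k)%N + r (n + k)%N <= y n + r n.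
  elim: k => [|k IH]; first by rewrite addn0.
  rewrite addnS; apply: le_trans _ IH.
  by have := yr (n + k)%N; rewrite ler_norml => /andP[]; lra.
(* Both endpoints are compared with those of the common later interval, of index [n + m]. *)
have ub m n : y n - r n <= y m + r m.
  have := incr n m; have := decr m n; rewrite addnC.
  by have := r0 (n + m)%N; lra.
pose E := range (fun n => y n - r n).
exists (sup E) => n; rewrite ler_distl; apply/andP; split.
  apply: ub_le_sup; last by exists n.
  by exists (y n + r n) => _ [k _ <-]; exact: ub.
apply: ge_sup; first by exists (y 0%N - r 0%N), 0%N.
by move=> _ [k _ <-]; exact: ub.
Qed.

(* Suppose the finite rows [f p] have unbounded [l1] norms.  Starting from
   [y 0 = 0], add to [y n] the vector [s 3^-n sg (f (P n))], where the norm of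
   [f (P n)] exceeds [2 n 3^n] and the sign [s] prevents any cancellation with
   [y n].  The later steps change the value by at most half of what has been
   gained, so the limit [x] of [y] has [|f (P n) x| >= n] for all [n]. *)
Lemma c0_uniform_bounded_finite (R : realType) (f : nat -> nat -> R)
    (N : nat -> nat) :
  (forall x : nat -> R, x @ \oo --> (0 : R) ->
    exists C, forall p, `|\sum_(0 <= k < N p) f p k * x k| <= C) ->
  exists C, forall p, \sum_(0 <= k < N p) `|f p k| <= C.
Proof.
move=> bnd; apply: contrapT => unbnd.
have /choice[P PP] (n : nat) :
    exists p, 2 * n%:R * 3 ^+ n < \sum_(0 <= k < N p) `|f p k|.
  apply: contrapT => h; apply: unbnd; exists (2 * n%:R * 3 ^+ n) => p.
  by rewrite leNgt; apply/negP => h'; apply: h; exists p.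
pose L n (x : nat -> R) := \sum_(0 <= k < N (P n)) f (P n) k * x k.
pose nrm n := \sum_(0 <= k < N (P n)) `|f (P n) k|.
pose sg n k := if (k < N (P n))%N then Num.sg (f (P n) k) else 0.
pose s n (x : nat -> R) : R := if 0 <= L n x then 1 else - 1.
pose y := fix y n : nat -> R := if n is n'.+1 then
  (fun k => y n' k + s n' (y n') * (3 ^- n' * sg n' k)) else (fun=> 0).
have yS n k : y n.+1 k = y n k + s n (y n) * (3 ^- n * sg n k) by [].
have i3 n : 0 < 3 ^- n :> R by rewrite invr_gt0 exprn_gt0.
have sg1 n k : `|sg n k| <= 1.
  rewrite /sg; case: ifP => _; last by rewrite normr0.
  by rewrite normr_sg; case: (_ != _).
have s1 n x : `|s n x| = 1 by rewrite /s; case: ifP; rewrite ?normrN normr1.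
(* The sum of all step sizes [3^-j] with [j >= n]; thus [r n.+1] is half of the step [3 ^- n]. *)
pose r (n : nat) : R := 3 / 2 * 3 ^- n.
have rS n : r n - r n.+1 = 3 ^- n.
  by rewrite /r exprS invfM; field; rewrite expf_neq0 ?pnatr_eq0.
have /choice[x xy] k : exists x, forall n, `|x - y n k| <= r n.
  apply: nested_intervals_pt => n; last by rewrite /r mulr_ge0// ltW.
  rewrite rS yS addrAC subrr add0r !normrM s1 mul1r (gtr0_norm (i3 n)).
  by rewrite ler_piMr// ltW.
(* Finite supports make the limit [x] a null sequence: far out, [y n k = 0] and [x k] is within
   [r n] of it. *)
have suppy n : exists K, forall k, (K <= k)%N -> y n k = 0.
  elim: n => [|n [K HK]]; first by exists 0%N.
  exists (maxn K (N (P n))) => k; rewrite geq_max => /andP[Kk Nk].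
  by rewrite yS HK// /sg ltnNge Nk/= !mulr0 addr0.
have r_cvg : r @ \oo --> (0 : R).
  rewrite /r -(mulr0 (3 / 2)); apply: cvgMl_tmp => //=.
  rewrite (_ : (fun n => 3 ^- n) = (fun n => (3^-1) ^+ n)).
    by apply: cvg_expr; rewrite gtr0_norm ?invr_gt0 ?invf_lt1 ?ltr1n.
  by apply/funext => n; rewrite exprVn.
have xc0 : x @ \oo --> (0 : R).
  apply/cvgrPdist_le => e e0.
  move/cvgrPdist_le : r_cvg => /(_ e e0)[n _ /(_ n (leqnn n))/=].
  rewrite sub0r normrN => rne.
  have [K HK] := suppy n.
  exists K => // k /= Kk; rewrite sub0r normrN.
  have := xy k n; rewrite HK// subr0 => /le_trans; apply.
  exact: le_trans (ler_norm _) rne.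
have [C HC] := bnd _ xc0.
have nrm0 n : 0 <= nrm n by apply: sumr_ge0.
have LB n u v : L n u - L n v = L n (u - v).
  by rewrite /L -sumrB; apply: eq_bigr => k _; rewrite -mulrBr.
have Lstep n : L n (y n.+1) = L n (y n) + s n (y n) * (3 ^- n * nrm n).
  rewrite /L /nrm !mulr_sumr -big_split; apply: eq_big_nat => k /andP[_ kN] /=.
  by rewrite mulrDr /sg kN (normrEsg (f (P n) k)); congr (_ + _); ring.
have Lge n : 3 ^- n * nrm n <= `|L n (y n.+1)|.
  rewrite Lstep /s; have := mulr_ge0 (ltW (i3 n)) (nrm0 n).
  set t := _ * nrm n => t0; case: ifPn; rewrite -?ltNge => h.
    by rewrite ler_normr; apply/orP; left; lra.
  by rewrite ler_normr; apply/orP; right; lra.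
have Lx n : n%:R <= `|L n x|.
  have : `|L n x - L n (y n.+1)| <= nrm n * r n.+1.
    rewrite LB /L /nrm mulr_suml; apply: (le_trans (ler_norm_sum _ _ _)).
    by apply: ler_sum => k _; rewrite normrM ler_wpM2l//; exact: xy.
  have : `|L n (y n.+1)| <= `|L n x| + `|L n x - L n (y n.+1)|.
    by rewrite distrC addrC -lerBlDr; exact: lerB_dist.
  have := Lge n.
  have : n%:R < 3 ^- n * nrm n / 2.
    rewrite ltr_pdivlMr// ltr_pdivlMl ?exprn_gt0//.
    by rewrite mulrC (mulrC n%:R); exact: PP.
  by move: (rS n); rewrite /r; nra.
have [n nC] : exists n : nat, C < n%:R.
  by exists (Num.truncn C).+1; exact: truncnS_gt.
by have := lt_le_trans nC (le_trans (Lx n) (HC (P n))); rewrite ltxx.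
Qed.


(** * Rows in l1 and uniform boundedness on c_0 *)

Lemma bounded_funE (R : realType) (T : Type) (V : normedModType R)
    (f : T -> V) :
  bounded_fun f <-> exists C, forall t, `|f t| <= C.
Proof.
split=> [|[C fC]]; last first.
  exists C; split; first exact: num_real.
  by move=> x Cx t _; exact: le_trans (fC t) (ltW Cx).
move=> [C [_ HC]]; exists (C + 1) => t; apply: HC => //.
by rewrite ltrDl.
Qed.

Lemma series_abs_cvg (R : realType) (a : nat -> R) (C : R) :
  (forall n, \sum_(0 <= k < n) `|a k| <= C) -> cvgn (series (fun k => `|a k|)).
Proof.
move=> aC; apply: nondecreasing_is_cvgn; first exact: nondecreasing_series.
by exists C => _ [n _ <-]; exact: aC.
Qed.

(** The Hölder inequality between l1 and the bounded sequences; a bound on partial sums gives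
    absolute convergence and the estimate together. *)
Lemma series_mul_bounded (R : realType) (a x : nat -> R) (C M : R) :
  (forall n, \sum_(0 <= k < n) `|a k| <= C) -> (forall k, `|x k| <= M) ->
  cvgn (series (fun k => a k * x k)) /\
  `|limn (series (fun k => a k * x k))| <= C * M.
Proof.
move=> aC xM.
have M0 : 0 <= M := le_trans (normr_ge0 _) (xM 0%N).
have axC n : \sum_(0 <= k < n) `|a k * x k| <= C * M.
  apply: (@le_trans _ _ ((\sum_(0 <= k < n) `|a k|) * M)); last exact: ler_wpM2r.
  by rewrite mulr_suml; apply: ler_sum => k _; rewrite normrM ler_wpM2l.
have ncvg := series_abs_cvg axC.
split; first exact: normed_cvg.
apply: le_trans (lim_series_norm ncvg) _; apply: limr_le => //.
by apply: nearW => n; exact: axC.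
Qed.

(** With every row equal to [a] and cut-offs [N p = p], the finite sums of the gliding hump lemma
    are the partial sums of a convergent series, hence bounded. *)
Lemma series_c0_cvg_l1 (R : realType) (a : nat -> R) :
  (forall x : nat -> R, x @ \oo --> (0 : R) ->
    cvgn (series (fun k => a k * x k))) ->
  exists C, forall n, \sum_(0 <= k < n) `|a k| <= C.
Proof.
move=> acvg.
have [x x0|C] := @c0_uniform_bounded_finite R (fun=> a) id; last by exists C.
by have /bounded_funE := cvg_seq_bounded (acvg x x0).
Qed.

(* The tails of the rows are cut off where their l1 norms are at most 1. *)
Lemma c0_uniform_bounded (R : realType) (f : nat -> nat -> R) :
  (forall x : nat -> R, x @ \oo --> (0 : R) ->
    (forall p, cvgn (series (fun k => f p k * x k))) /\
    exists C, forall p, `|limn (series (fun k => f p k * x k))| <= C) ->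
  exists C, forall p n, \sum_(0 <= k < n) `|f p k| <= C.
Proof.
move=> fbnd.
have /choice[N NP] p : exists N, forall n, (N <= n)%N ->
    \sum_(N <= k < n) `|f p k| <= 1.
  (* Each single row is in l1, so the Cauchy criterion with tolerance 1 supplies its cut-off. *)
  have [C HC] := @series_c0_cvg_l1 _ (f p) (fun x x0 => (fbnd x x0).1 p).
  have /cauchy_cvgP/cauchy_seriesP/(_ 1 ltr01) := series_abs_cvg HC.
  case=> -[A B] /= [[N1 _ HA] [N2 _ HB]] AB.
  exists (maxn N1 N2) => n Nn.
  have := AB (maxn N1 N2, n); rewrite /= ger0_norm ?sumr_ge0// => AB'.
  apply/ltW/AB'; split; [apply: HA|apply: HB] => /=; first exact: leq_maxl.
  exact: leq_trans (leq_maxr _ _) Nn.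
have [x x0|C HC] := @c0_uniform_bounded_finite R f N; last first.
  exists (C + 1) => p n; have [Nn|/ltnW nN] := leqP (N p) n.
    rewrite (big_cat_nat (leq0n _) Nn)//=.
    by apply: lerD; [exact: HC | exact: NP].
  apply: (@le_trans _ _ (\sum_(0 <= k < N p) `|f p k|)).
    by rewrite [leRHS](big_cat_nat (leq0n _) nN)/= lerDl sumr_ge0.
  by apply: le_trans (HC p) _; rewrite lerDl.
have [fcvg [C HC]] := fbnd x x0.
have [M xM] : exists M, forall k, `|x k| <= M.
  by apply/bounded_funE/cvg_seq_bounded; apply/cvg_ex; exists 0.
exists (C + M) => p.
have M0 : 0 <= M := le_trans (normr_ge0 _) (xM 0%N).
(* Since the tail has l1 norm at most 1, dropping it costs at most [M]; the estimate then passes to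
   the limit in [n]. *)
have near_lim n : (N p <= n)%N ->
    `|\sum_(0 <= k < N p) f p k * x k| <=
      `|series (fun k => f p k * x k) n| + M.
  move=> Nn; rewrite seriesEnat/= (big_cat_nat (leq0n _) Nn)//=.
  set u := \sum_(0 <= k < N p) _; set v := \sum_(N p <= k < n) _.
  have : `|v| <= M.
    apply: (le_trans (ler_norm_sum _ _ _)).
    apply: (@le_trans _ _ ((\sum_(N p <= k < n) `|f p k|) * M)).
      by rewrite mulr_suml; apply: ler_sum => k _; rewrite normrM ler_wpM2l.
    by rewrite ler_piMl// NP.
  by have := ler_normB (u + v) v; rewrite addrK; lra.
suff : `|\sum_(0 <= k < N p) f p k * x k| - M <=
    `|limn (series (fun k => f p k * x k))| by have := HC p; lra.
rewrite -lim_norm//; apply: limr_ge; first exact: is_cvg_norm.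
by exists (N p) => // n /= /near_lim; lra.
Qed.


(** * Dual filters and uniform convergence along an ideal *)

Lemma ideal_dualE (J : set (set nat)) (S : set nat) :
  ideal_dual J S <-> J (~` S).
Proof.
by split=> [[B JB <-]|JS]; [rewrite setCK | exists (~` S); rewrite ?setCK].
Qed.

Lemma ideal_dualT (J : set (set nat)) : is_ideal J -> ideal_dual J setT.
Proof. by move=> hJ; apply/ideal_dualE; rewrite setCT; exact: ideal_finite. Qed.

Lemma ideal_dualI (J : set (set nat)) (S S' : set nat) : is_ideal J ->
  ideal_dual J S -> ideal_dual J S' -> ideal_dual J (S `&` S').
Proof.
move=> hJ /ideal_dualE JS /ideal_dualE JS'; apply/ideal_dualE.
by rewrite setCI; exact: idealU.
Qed.

(** Induction on a list of indices. This lets coordinates and matrix entries be treated one at a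
    time. *)
Lemma ideal_dual_bigcap (J : set (set nat)) (r : finType) (S : r -> set nat) :
  is_ideal J -> (forall i, ideal_dual J (S i)) ->
  ideal_dual J [set n | forall i, S i n].
Proof.
move=> hJ JS.
suff h (s : seq r) : ideal_dual J [set n | forall i, i \in s -> S i n].
  have := h (enum r); congr ideal_dual; apply/seteqP.
  by split=> n Sn i; [apply: Sn; rewrite mem_enum | move=> _; exact: Sn].
elim: s => [|i s IH].
  rewrite (_ : mkset _ = setT); first exact: ideal_dualT.
  by apply/seteqP; split.
rewrite (_ : mkset _ = S i `&` [set n | forall i, i \in s -> S i n]).
  exact: ideal_dualI.
apply/seteqP; split=> n /= Sn.
  by split=> [|j js]; apply: Sn; rewrite inE ?eqxx// js orbT.
by move=> j; rewrite inE => /orP[/eqP->|]; [exact: Sn.1 | exact: Sn.2].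
Qed.

Lemma ideal_ucvg_dist (R : realType) (J : set (set nat)) (V : Type) (N : set V)
    (X : normedModType R) (y : V -> nat -> X) (l : X) :
  ideal_ucvg J N y l <-> forall e : R, 0 < e -> exists2 S, ideal_dual J S &
    forall n v, S n -> N v -> `|l - y v n| < e.
Proof.
split=> [yl e e0|yl U /nbhs_ballP[e /= e0 eU]].
  have [|S JS HS] := yl (ball l e); first exact: nbhsx_ballx.
  by exists S => // n v Sn Nv; have := HS n v Sn Nv; rewrite -ball_normE.
have [S JS HS] := yl e e0; exists S => // n v Sn Nv.
by apply: eU; rewrite -ball_normE; exact: HS.
Qed.

(** Columns carry the maximum norm, so a ball is cut out by its coordinate balls, and the finitely
    many sets of [J^*] are intersected. *)
Lemma ideal_ucvg_coord (R : realType) (J : set (set nat)) (V : Type)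
    (N : set V) (m : nat) (y : V -> nat -> 'cV[R]_m) (l : 'cV[R]_m) :
  is_ideal J -> ideal_ucvg J N y l <->
  forall i, ideal_ucvg J N (fun v n => y v n i 0) (l i 0).
Proof.
move=> hJ; split=> [yl i U Ul|yl U /nbhs_ballP[e /= e0 eU]].
  exact: yl (coord_continuous Ul).
have /choice[S HS] i : exists S, ideal_dual J S /\ forall n v, S n -> N v ->
    ball (l i 0) e (y v n i 0).
  by have [|S JS HS] := yl i (ball (l i 0) e); [exact: nbhsx_ballx | exists S].
exists [set n | forall i, S i n].
  by apply: ideal_dual_bigcap => // i; exact: (HS i).1.
move=> n v Sn Nv; apply: eU; split=> // i j; rewrite (ord1 j).
exact: (HS i).2.
Qed.

Lemma ideal_ucvgD (R : realType) (J : set (set nat)) (V : Type) (N : set V)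
    (X : normedModType R) (y z : V -> nat -> X) (l l' : X) : is_ideal J ->
  ideal_ucvg J N y l -> ideal_ucvg J N z l' ->
  ideal_ucvg J N (fun v n => y v n + z v n) (l + l').
Proof.
move=> hJ /ideal_ucvg_dist yl /ideal_ucvg_dist zl; apply/ideal_ucvg_dist => e e0.
have e2 : 0 < e / 2 by rewrite divr_gt0.
have [S JS HS] := yl _ e2; have [S' JS' HS'] := zl _ e2.
exists (S `&` S'); first exact: ideal_dualI.
move=> n v [Sn Sn'] Nv; rewrite opprD addrACA (splitr e).
by apply: le_lt_trans (ler_normD _ _) (ltrD _ _); [exact: HS | exact: HS'].
Qed.

Lemma ideal_ucvg_sum (R : realType) (J : set (set nat)) (V : Type) (N : set V)
    (X : normedModType R) (r : finType) (y : r -> V -> nat -> X) (l : r -> X) :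
  is_ideal J -> (forall i, ideal_ucvg J N (y i) (l i)) ->
  ideal_ucvg J N (fun v n => \sum_i y i v n) (\sum_i l i).
Proof.
move=> hJ yl; elim: (index_enum r) => [|i s IH].
  move=> U U0; exists setT; first exact: ideal_dualT.
  by move=> n v _ _; move: U0; rewrite !big_nil => /nbhs_singleton.
rewrite big_cons (_ : (fun _ _ => _) =
    fun v n => y i v n + \sum_(i <- s) y i v n); first exact: ideal_ucvgD.
by apply/funext => v; apply/funext => n; rewrite big_cons.
Qed.

Lemma ideal_ucvg_cvg (J : set (set nat)) (V : Type) (N : set V)
    (X : topologicalType) (y : V -> nat -> X) (l : X) (v : V) : is_ideal J ->
  N v -> ideal_ucvg J N y l -> ideal_cvg J (y v) l.
Proof.
move=> hJ Nv yl U /yl[S /ideal_dualE JS HS]; apply: idealS JS => // n /=.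
by move=> nU Sn; apply: nU; exact: HS.
Qed.

Lemma ideal_cvg_coord (R : realType) (I : set (set nat)) (d : nat)
    (x : nat -> 'cV[R]_d) (l : 'cV[R]_d) (j : 'I_d) :
  ideal_cvg I x l -> ideal_cvg I (fun k => x k j 0) (l j 0).
Proof. by move=> xl U /coord_continuous; exact: xl. Qed.

Lemma cvg_ideal_cvg (I : set (set nat)) (X : topologicalType) (x : nat -> X)
    (l : X) : is_ideal I -> x @ \oo --> l -> ideal_cvg I x l.
Proof.
move=> hI xl U /xl[n _ nU]; apply: ideal_finite => //.
apply: sub_finite_set (finite_II n) => k /= kU.
by rewrite ltnNge; apply/negP => /nU.
Qed.

Lemma coord_cvg (R : realType) (m : nat) (x : nat -> 'cV[R]_m) (l : 'cV[R]_m) :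
  (forall i, (fun n => x n i 0) @ \oo --> l i 0) -> x @ \oo --> l.
Proof.
move=> xl; apply/cvg_ballP => e e0.
have : \forall n \near \oo, forall i, ball (l i 0) e (x n i 0).
  apply: filter_forall => i; by have /cvg_ballP := xl i; apply.
apply: filterS => n xn; split=> // i j; rewrite (ord1 j); exact: xn.
Qed.

Lemma norm_coord_le (R : realType) (m : nat) (x : 'cV[R]_m) (i : 'I_m) :
  `|x i 0| <= `|x|.
Proof.
rewrite [leRHS]/Num.Def.normr /= mx_normrE; apply/bigmax_geP; right => /=.
by exists (i, 0).
Qed.

Lemma norm_col_le (R : realType) (m : nat) (x : 'cV[R]_m) (C : R) :
  0 <= C -> (forall i, `|x i 0| <= C) -> `|x| <= C.
Proof.
move=> C0 xC; rewrite [leLHS]/Num.Def.normr /= mx_normrE.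
apply/bigmax_leP; split=> //.
by move=> [i j] _ /=; rewrite (ord1 j).
Qed.


(** * Bounded rows applied to sequences convergent along an ideal *)

(* Bisection on the range: subtracting from [w] half of its bound on the two
   level sets where it is exceeded, which belong to [I], halves the bound. *)
Lemma ideal_null_series_small (R : realType) (I J : set (set nat)) (V : Type)
    (N : set V) (b : V -> nat -> nat -> R) (C : R) (J0 : set nat) (l : nat) :
  is_ideal I -> is_ideal J -> ideal_dual J J0 ->
  (forall v n K, N v -> J0 n -> \sum_(0 <= k < K) `|b v n k| <= C) ->
  (forall E, I E -> ideal_ucvg J N
    (fun v n => limn (series (fun k => b v n k * \1_E k))) 0) ->
  forall (w : nat -> R) (M : R), 0 < M -> (forall k, `|w k| <= M) ->
  (forall e : R, 0 < e -> I [set k | e < `|w k|]) ->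
  forall e : R, 0 < e -> exists2 S, ideal_dual J S & forall n v, S n -> N v ->
    `|limn (series (fun k => b v n k * w k))| <= C * M / 2 ^+ l + e.
Proof.
(* The sequence and its bound stay general in the induction, as each step replaces [w], [M] by [w'],
   [M / 2]. For [l = 0] the Hölder bound [C * M] is enough. *)
move=> hI hJ J0J bC bE; elim: l => [|l IH] w M M0 wM wI e e0.
  exists J0 => // n v Jn Nv.
  have [_] := series_mul_bounded (fun K => bC v n K Nv Jn) wM.
  by rewrite expr0 divr1; lra.
have M2 : 0 < M / 2 by rewrite divr_gt0.
pose P := [set k | M / 2 < w k]; pose Q := [set k | w k < - (M / 2)].
have IP : I P.
  by apply: idealS (wI _ M2) => // k /= /lt_le_trans; apply; exact: ler_norm.
have IQ : I Q.
  apply: idealS (wI _ M2) => // k; rewrite /Q /= ltrNr => /lt_le_trans; apply.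
  by rewrite -normrN; exact: ler_norm.
pose w' k : R := w k - M / 2 * \1_P k + M / 2 * \1_Q k.
have w'E k : [\/ P k /\ w' k = w k - M / 2, Q k /\ w' k = w k + M / 2
   | (~ P k /\ ~ Q k) /\ w' k = w k].
  rewrite /w' !indicE.
  have [Pk|Pk] := pselect (P k); have [Qk|Qk] := pselect (Q k).
  - by move: (Pk) (Qk); rewrite /P /Q /=; lra.
  - by constructor 1; rewrite mem_set// memNset//=; split=> //; ring.
  - by constructor 2; rewrite memNset// mem_set//=; split=> //; ring.
  - by constructor 3; rewrite memNset// memNset//=; split=> //; ring.
have w'M k : `|w' k| <= M / 2.
  have := wM k; rewrite !ler_norml => /andP[wl wr].
  case: (w'E k) => -[+ ->]; rewrite /P /Q /=.
  - by move=> h; apply/andP; split; lra.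
  - by move=> h; apply/andP; split; lra.
  - by move=> [/negP + /negP]; rewrite -!leNgt => ? ?; apply/andP; split; lra.
(* Off [P] and [Q] the sequences agree, so a level set of [w'] lies in the union of [P], [Q] and a
   level set of [w]. *)
have w'I (u : R) : 0 < u -> I [set k | u < `|w' k|].
  move=> u0; apply: idealS (idealU hI (idealU hI IP IQ) (wI u u0)) => // k /=.
  by case: (w'E k) => -[+ ->]; [left; left | left; right | right].
have e2 : 0 < e / 2 by rewrite divr_gt0.
(* With this tolerance for both indicators, the correction [(M / 2) *: (p - q)] is at most
   [e / 2]. *)
have eM : 0 < e / 2 / M by rewrite !divr_gt0.
have [S JS HS] := IH w' (M / 2) M2 w'M w'I _ e2.
have /ideal_ucvg_dist/(_ _ eM)[SP JSP HP] := bE _ IP.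
have /ideal_ucvg_dist/(_ _ eM)[SQ JSQ HQ] := bE _ IQ.
exists ((J0 `&` S) `&` (SP `&` SQ)); first by do 2?apply: ideal_dualI.
move=> n v [[Jn Sn] [SPn SQn]] Nv.
have bn K := bC v n K Nv Jn.
have indM (E : set nat) k : `|\1_E k| <= 1 :> R.
  by rewrite indicE; case: (_ \in _); rewrite ?normr1 ?normr0.
have [cP _] := series_mul_bounded bn (indM P).
have [cQ _] := series_mul_bounded bn (indM Q).
have [cw _] := series_mul_bounded bn w'M.
have -> : (fun k => b v n k * w k) = (fun k => b v n k * w' k) +
    (M / 2) *: ((fun k => b v n k * \1_P k) - (fun k => b v n k * \1_Q k)).
  apply/funext => k; rewrite /w' !fctE /GRing.scale/=; ring.
have cPQ := is_cvg_seriesB cP cQ.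
rewrite lim_seriesD//; last exact: is_cvg_seriesZ.
rewrite lim_seriesZ// lim_seriesB//.
have := HS n v Sn Nv; have := HP n v SPn Nv; have := HQ n v SQn Nv.
rewrite !sub0r !normrN.
set q := limn (series (fun k => b v n k * \1_Q k)).
set p := limn (series (fun k => b v n k * \1_P k)).
set z := limn (series (fun k => b v n k * w' k)) => hq hp hz.
have : `|(M / 2) *: (p - q)| <= e / 2.
  rewrite normrM gtr0_norm//.
  have : `|p - q| <= e / M.
    rewrite [e in leRHS]splitr mulrDl.
        by apply: le_trans (ler_normB _ _) _; apply: lerD; exact: ltW.
  by rewrite ler_pdivlMr//; lra.
have := ler_normD z ((M / 2) *: (p - q)).
rewrite exprS invfM mulrA -(mulrA C); lra.
Qed.

(** Splitting [y] as [w + eta], bisection handles the null part [w], and the row sums handle the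
    constant [eta]. *)
Lemma series_uniform_ideal_cvg (R : realType) (I J : set (set nat)) (V : Type)
    (N : set V) (b : V -> nat -> nat -> R) (C : R) (J0 : set nat)
    (t eta : R) (y : nat -> R) :
  is_ideal I -> is_ideal J -> ideal_dual J J0 ->
  (forall v n K, N v -> J0 n -> \sum_(0 <= k < K) `|b v n k| <= C) ->
  (forall E, I E -> ideal_ucvg J N
    (fun v n => limn (series (fun k => b v n k * \1_E k))) 0) ->
  ideal_ucvg J N (fun v n => limn (series (b v n))) t ->
  bounded_fun y -> ideal_cvg I y eta ->
  ideal_ucvg J N (fun v n => limn (series (fun k => b v n k * y k))) (t * eta).
Proof.
move=> hI hJ J0J bC bE /ideal_ucvg_dist bt /bounded_funE[M yM] yeta.
apply/ideal_ucvg_dist => e e0.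
pose w k := y k - eta.
(* The summand 1 makes the bound on [w] strictly positive, as the bisection requires. *)
pose M' := M + `|eta| + 1.
have M0 : 0 <= M := le_trans (normr_ge0 _) (yM 0%N).
have M'0 : 0 < M' by rewrite ltr_wpDl// addr_ge0.
have wM k : `|w k| <= M'.
  by have := ler_normB (y k) eta; have := yM k; rewrite /M' /w; lra.
have wI (u : R) : 0 < u -> I [set k | u < `|w k|].
  move=> u0; have := yeta (ball eta u) (nbhsx_ballx _ _ u0).
  apply: idealS => // k /=; rewrite -ball_normE /= /w distrC => h /ltW.
  by rewrite leNgt h.
(* Enough halvings to bring the main term below [e / 4], by [l < 2 ^ l]. Three errors of [e / 4]
   then add up to less than [e]. *)
have [l Cl] : exists l, C * M' / 2 ^+ l <= e / 4.
  exists (Num.truncn ((e / 4)^-1 * (C * M'))).+1.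
  rewrite ler_pdivrMr ?exprn_gt0// -ler_pdivrMl ?divr_gt0//.
  apply/ltW/(lt_trans (truncnS_gt _)).
  by rewrite -(natrX R 2) ltr_nat; exact: ltn_expl.
have e4 : 0 < e / 4 by rewrite divr_gt0.
have [S JS HS] := ideal_null_series_small l hI hJ J0J bC bE M'0 wM wI e4.
have et : 0 < e / 4 / (`|eta| + 1) by rewrite !divr_gt0// ltr_wpDl.
have [S' JS' HS'] := bt _ et.
exists (J0 `&` (S `&` S')); first by do 2?apply: ideal_dualI.
move=> n v [Jn [Sn Sn']] Nv.
have bn K := bC v n K Nv Jn.
have [cw _] := series_mul_bounded bn wM.
have [c1 _] : cvgn (series (fun k => b v n k * 1)) /\ _ :=
  series_mul_bounded bn (fun=> lexx `|1|).
have b1 : (fun k => b v n k * 1) = b v n by apply/funext => k; rewrite mulr1.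
rewrite b1 in c1.
have -> : (fun k => b v n k * y k) = (fun k => b v n k * w k) + eta *: b v n.
  by apply/funext => k; rewrite /w !fctE /GRing.scale/=; ring.
rewrite lim_seriesD//; last exact: is_cvg_seriesZ.
rewrite lim_seriesZ//.
have := HS n v Sn Nv; have := HS' n v Sn' Nv.
set z := limn (series (b v n)).
set q := limn (series (fun k => b v n k * w k)).
rewrite ltr_pdivlMr ?ltr_wpDl// => hq hz.
have -> : t * eta - (q + eta *: z) = eta * (t - z) - q.
  by rewrite /GRing.scale/=; ring.
apply: le_lt_trans (ler_normB _ _) _; rewrite normrM.
by have := normr_ge0 (t - z); nra.
Qed.


(** * Coordinates of operator matrices and their row sums *)

Lemma op_series_coord (R : realType) (d m : nat)
    (A : op_matrix 'cV[R]_d 'cV[R]_m) (x : nat -> 'cV[R]_d) (n K : nat)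
    (i : 'I_m) :
  series (fun k => A n k (x k)) K i 0 =
  \sum_j series (fun k => opmx (A n k) i j * x k j 0) K.
Proof.
rewrite /series /= summxE exchange_big /=; apply: eq_bigr => k _.
by rewrite opmxE mxE.
Qed.

(** Convergence in [R^m] is coordinatewise, and each coordinate is a finite sum over [j] of scalar
    series. *)
Lemma op_apply_coord (R : realType) (d m : nat)
    (A : op_matrix 'cV[R]_d 'cV[R]_m) (x : nat -> 'cV[R]_d) :
  (forall n i j, cvgn (series (fun k => opmx (A n k) i j * x k j 0))) ->
  op_dom A x /\ forall n i, op_apply A x n i 0 =
    \sum_j limn (series (fun k => opmx (A n k) i j * x k j 0)).
Proof.
move=> cA.
pose l n : 'cV[R]_m :=
  \col_i \sum_j limn (series (fun k => opmx (A n k) i j * x k j 0)).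
have cvgl n : series (fun k => A n k (x k)) @ \oo --> l n.
  apply: coord_cvg => i; rewrite mxE.
  rewrite (_ : (fun K => _) = fun K =>
      \sum_j series (fun k => opmx (A n k) i j * x k j 0) K).
    by apply: cvg_big => [|j _]; [exact: add_continuous | exact: cA].
  by apply/funext => K; exact: op_series_coord.
split=> [n|n i]; first by apply/cvg_ex; exists (l n).
by rewrite /op_apply (cvg_lim _ (cvgl n))// mxE.
Qed.

(** A sequence along one basis vector isolates one column of entries. Here the scalar series inherit
    convergence from the vector series, by continuity of coordinates. *)
Lemma op_apply_axis (R : realType) (d m : nat)
    (A : op_matrix 'cV[R]_d 'cV[R]_m) (z : nat -> R) (j : 'I_d) :
  op_dom A (fun k => z k *: delta_mx j 0) -> forall n i,
  cvgn (series (fun k => opmx (A n k) i j * z k)) /\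
  op_apply A (fun k => z k *: delta_mx j 0) n i 0 =
    limn (series (fun k => opmx (A n k) i j * z k)).
Proof.
move=> dA n i.
have sE K : series (fun k => A n k (z k *: delta_mx j 0)) K i 0 =
    series (fun k => opmx (A n k) i j * z k) K.
  rewrite /series /= summxE; apply: eq_bigr => k _.
  by rewrite linearZ !mxE mulrC.
have : (fun K => series (fun k => A n k (z k *: delta_mx j 0)) K i 0) @ \oo -->
    op_apply A (fun k => z k *: delta_mx j 0) n i 0.
  apply: (cvg_comp _ (fun M : 'cV[R]_m => M i 0) (dA n)).
  exact: coord_continuous.
rewrite (funext sE) => h; split; first by apply/cvg_ex; eexists; exact: h.
by rewrite (cvg_lim _ h).
Qed.

Lemma abs_row_sum_le (R : realType) (d m : nat)
    (A : op_matrix 'cV[R]_d 'cV[R]_m) (n : nat) (C : 'I_m -> 'I_d -> R) :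
  (forall i j K, \sum_(0 <= k < K) `|opmx (A n k) i j| <= C i j) ->
  (abs_row_sum A n <= (\sum_i \sum_j C i j)%:E)%E.
Proof.
move=> hC; apply: lime_le.
  apply: is_cvg_nneseries => k _ _.
  by rewrite lee_fin sumr_ge0// => ? _; exact: sumr_ge0.
apply: nearW => K; rewrite sumEFin lee_fin exchange_big/=.
apply: ler_sum => i _; rewrite exchange_big/=.
by apply: ler_sum => j _; exact: hC.
Qed.

Lemma le_abs_row_sum (R : realType) (d m : nat)
    (A : op_matrix 'cV[R]_d 'cV[R]_m) (n : nat) (C : R) (i : 'I_m) (j : 'I_d)
    (K : nat) :
  (abs_row_sum A n <= C%:E)%E -> \sum_(0 <= k < K) `|opmx (A n k) i j| <= C.
Proof.
move=> hC; rewrite -lee_fin; apply: le_trans hC.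
apply: le_trans (nneseries_lim_ge K _); last first.
  by move=> k _ _; rewrite lee_fin sumr_ge0// => ? _; exact: sumr_ge0.
rewrite sumEFin lee_fin; apply: ler_sum => k _.
rewrite (bigD1 i)//= (bigD1 j)//= -addrA lerDl addr_ge0 ?sumr_ge0//.
by move=> i' _; exact: sumr_ge0.
Qed.

Lemma ereal_sup_lty (R : realType) (E : set (\bar R)) :
  (ereal_sup E < +oo)%E -> exists C : R, forall x, E x -> (x <= C%:E)%E.
Proof.
have := @ereal_sup_ubound R E.
case: (ereal_sup E) => [C||] // ub _; first by exists C => x /ub.
(* If the supremum is [-oo], every element is [-oo] and any real number is a bound. *)
by exists 0 => x /ub /le_trans; apply; rewrite leNye.
Qed.

Lemma ereal_sup_le_lty (R : realType) (E : set (\bar R)) (C : R) :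
  (forall x, E x -> (x <= C%:E)%E) -> (ereal_sup E < +oo)%E.
Proof. by move=> EC; apply: le_lt_trans (ltry C); exact: ge_ereal_sup. Qed.

(** The common source of all necessity arguments: regularity tested on [z k *: delta_mx j 0] and
    read in coordinate [i]. *)
Lemma regular_entry (R : realType) (d m : nat)
    (AA : set (op_matrix 'cV[R]_d 'cV[R]_m))
    (T : {linear 'cV[R]_d -> 'cV[R]_m}) (I J : set (set nat)) (z : nat -> R)
    (eta : R) (i : 'I_m) (j : 'I_d) :
  is_ideal J -> regular I J AA T -> bounded_fun z -> ideal_cvg I z eta ->
  [/\ forall A n, AA A -> cvgn (series (fun k => opmx (A n k) i j * z k)),
      forall A, AA A -> exists C, forall n,
        `|limn (series (fun k => opmx (A n k) i j * z k))| <= C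
    & ideal_ucvg J AA
        (fun A n => limn (series (fun k => opmx (A n k) i j * z k)))
        (opmx T i j * eta)].
Proof.
move=> hJ [AAdom AAlim] /bounded_funE[M zM] zeta.
pose x k : 'cV[R]_d := z k *: delta_mx j 0.
have xeta : ideal_cvg I x (eta *: delta_mx j 0).
  move=> U /(@scalel_continuous _ _ (delta_mx j 0 : 'cV[R]_d) eta); exact: zeta.
have xcb : cb 'cV[R]_d I x.
  split; last by exists (eta *: delta_mx j 0).
  apply/bounded_funE; exists (M * `|delta_mx j 0 : 'cV[R]_d|) => k.
  by rewrite normrZ ler_wpM2r.
have xE A n : AA A -> _ := fun AAA => op_apply_axis ((AAdom A AAA).1 x xcb) n i.
split=> [A n AAA|A AAA|].
- exact: (xE A n AAA).1.
- have [/bounded_funE[C HC] _] := (AAdom A AAA).2 x xcb.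
  exists C => n; rewrite -(xE A n AAA).2; apply: le_trans (HC n).
  exact: norm_coord_le.
- have /(ideal_ucvg_coord _ _ _ hJ)/(_ i) := AAlim x xcb _ xeta.
  rewrite linearZ !mxE mulrC => h U /h[S JS HS]; exists S => // n A Sn AAA.
  by rewrite -(xE A n AAA).2; exact: HS.
Qed.


(** * Uniform row bounds and the two implications *)

Lemma lim_sum_mem (R : realType) (a : nat -> R) (E : set nat) :
  \big[+%R/0]_(0 <= k <oo | k \in E) a k =
  limn (series (fun k => a k * \1_E k)).
Proof.
congr (limn _); apply/funext => n; rewrite /series /= big_mkcond.
by apply: eq_bigr => k _; rewrite indicE; case: ifP; rewrite ?mulr1 ?mulr0.
Qed.

Lemma indic_ideal_cvg0 (R : realType) (I : set (set nat)) (E : set nat) :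
  is_ideal I -> I E -> ideal_cvg I (\1_E : nat -> R) 0.
Proof.
move=> hI IE U /nbhs_singleton U0; apply: idealS IE => // k /= nU.
by apply: contrapT => kE; apply: nU; rewrite indicE memNset.
Qed.

Lemma bounded_indic (R : realType) (E : set nat) :
  bounded_fun (\1_E : nat -> R).
Proof.
apply/bounded_funE; exists 1 => k.
by rewrite indicE; case: (_ \in _); rewrite ?normr1 ?normr0.
Qed.

(** The sets [D p], complements of the first [p] generators, decrease and are eventually inside each
    set of [J^*]. Indices picked from successive [D p] thus obey every uniform [J]-limit. *)
Lemma countably_generated_exhaustion (J : set (set nat)) :
  is_ideal J -> countably_generated J ->
  exists2 D : nat -> set nat, (forall p, ideal_dual J (D p)) &
    forall S, ideal_dual J S ->
      exists P, forall p n, (P <= p)%N -> D p n -> S n.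
Proof.
move=> hJ [G JG GJ].
exists (fun p => ~` \bigcup_(q in `I_p) G q) => [p|S /ideal_dualE/GJ[F finF SF]].
  by apply/ideal_dualE; rewrite setCK; apply/GJ; exists `I_p.
have [P FP] : exists P, F `<=` `I_P.
  have /finite_seqP[X ->] := finF.
  exists (\max_(q <- X) q).+1 => q /= qX.
  by rewrite ltnS; apply: leq_bigmax_seq.
exists P => p n Pp nD; apply: contrapT => /SF[q Fq Gq]; apply: nD.
by exists q => //=; apply: leq_trans Pp; exact: FP.
Qed.

(** Uniform boundedness for the rows of one matrix: on a null sequence [x] they are pointwise
    bounded because the transform is a bounded sequence. *)
Lemma regular_rows_bounded (R : realType) (d m : nat)
    (AA : set (op_matrix 'cV[R]_d 'cV[R]_m))
    (T : {linear 'cV[R]_d -> 'cV[R]_m}) (I J : set (set nat))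
    (A : op_matrix 'cV[R]_d 'cV[R]_m) (i : 'I_m) (j : 'I_d) :
  is_ideal I -> is_ideal J -> regular I J AA T -> AA A ->
  exists C, forall n K, \sum_(0 <= k < K) `|opmx (A n k) i j| <= C.
Proof.
move=> hI hJ reg AAA.
apply: (@c0_uniform_bounded _ (fun n k => opmx (A n k) i j)) => x x0.
have bx : bounded_fun x by apply: cvg_seq_bounded; apply/cvg_ex; exists 0.
have [cA bA _] := regular_entry i j hJ reg bx (cvg_ideal_cvg hI x0).
by split=> [n|]; [exact: cA | exact: bA].
Qed.

Lemma regular_rows_ubounded (R : realType) (d m : nat)
    (AA : set (op_matrix 'cV[R]_d 'cV[R]_m))
    (T : {linear 'cV[R]_d -> 'cV[R]_m}) (I J : set (set nat))
    (i : 'I_m) (j : 'I_d) :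
  is_ideal I -> is_ideal J -> countably_generated J -> regular I J AA T ->
  exists S C, ideal_dual J S /\ forall A n K, AA A -> S n ->
    \sum_(0 <= k < K) `|opmx (A n k) i j| <= C.
Proof.
move=> hI hJ Jcg reg.
have [D JD DS] := countably_generated_exhaustion hJ Jcg.
apply: contrapT => unbnd.
(* The choice is diagonal: matrix and row index both vary with [p], so the bound for a single matrix
   does not apply. *)
have /choice[a aP] (p : nat) : exists u : op_matrix 'cV[R]_d 'cV[R]_m * nat,
    [/\ AA u.1, D p u.2 &
      exists K, p%:R < \sum_(0 <= k < K) `|opmx (u.1 u.2 k) i j|].
  apply: contrapT => none; apply: unbnd; exists (D p), p%:R; split=> //.
  move=> A n K AAA Dn; rewrite leNgt; apply/negP => big.
  by apply: none; exists (A, n); split=> //; exists K.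
pose f p k := opmx ((a p).1 (a p).2 k) i j.
have [x x0|C HC] := @c0_uniform_bounded _ f; last first.
  have [_ _ [K]] := aP (Num.truncn C).+1.
  apply/negP; rewrite -leNgt; apply: le_trans (HC _ _) _.
  exact/ltW/truncnS_gt.
have bx : bounded_fun x by apply: cvg_seq_bounded; apply/cvg_ex; exists 0.
have [cA _ uA] := regular_entry i j hJ reg bx (cvg_ideal_cvg hI x0).
split=> [p|]; first by apply: cA; case: (aP p).
move: uA; rewrite mulr0 => /ideal_ucvg_dist/(_ 1 ltr01)[S JS HS].
have [P PS] := DS S JS.
pose y p := `|limn (series (fun k => f p k * x k))|.
have y0 p : 0 <= y p by exact: normr_ge0.
(* From [P] on, the chosen rows lie in [S] and have values below 1; the sum absorbs the finitely
   many earlier ones. *)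
exists (1 + \sum_(0 <= p < P) y p) => p.
have [Pp|pP] := leqP P p.
  apply: (@le_trans _ _ 1); last by rewrite lerDl sumr_ge0.
  have [AAa Da _] := aP p.
  by have := HS _ _ (PS _ _ Pp Da) AAa; rewrite sub0r normrN; exact: ltW.
rewrite big_mkord (bigD1 (Ordinal pP))//= addrCA lerDl addr_ge0// sumr_ge0//.
Qed.

(** The bounds have separate uses: the one for each matrix, over all rows, gives its domain and
    bounded transforms; the common one on [S] gives uniform limits. *)
Lemma absolute_rows_regular (R : realType) (d m : nat)
    (AA : set (op_matrix 'cV[R]_d 'cV[R]_m))
    (T : {linear 'cV[R]_d -> 'cV[R]_m}) (I J : set (set nat))
    (S : set nat) (C : R) :
  is_ideal I -> is_ideal J ->
  (forall A, AA A -> exists C', forall n i j K,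
    \sum_(0 <= k < K) `|opmx (A n k) i j| <= C') ->
  ideal_dual J S ->
  (forall A n i j K, AA A -> S n ->
    \sum_(0 <= k < K) `|opmx (A n k) i j| <= C) ->
  (forall i j, ideal_ucvg J AA
     (fun A n => limn (series (fun k => opmx (A n k) i j))) (opmx T i j)) ->
  (forall i j E, I E -> ideal_ucvg J AA
     (fun A n => limn (series (fun k => opmx (A n k) i j * \1_E k))) 0) ->
  regular I J AA T.
Proof.
move=> hI hJ rowC JS rowS d3 d4.
have applyE A x : AA A -> bounded_fun x ->
    op_dom A x /\ forall n i, op_apply A x n i 0 =
    \sum_j limn (series (fun k => opmx (A n k) i j * x k j 0)).
  move=> AAA /bounded_funE[M xM]; apply: op_apply_coord => n i j.
  have [C' HC'] := rowC A AAA.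
  apply: (series_mul_bounded (HC' n i j) _).1 => k.
  exact: le_trans (norm_coord_le _ _) (xM k).
have lim x eta : bounded_fun x -> ideal_cvg I x eta ->
    ideal_ucvg J AA (fun A n => op_apply A x n) (T eta).
  move=> bx xeta; apply/(ideal_ucvg_coord _ _ _ hJ) => i.
  have -> : T eta i 0 = \sum_j opmx T i j * eta j 0 by rewrite opmxE mxE.
  have ulim : ideal_ucvg J AA (fun A n => \sum_j
      limn (series (fun k => opmx (A n k) i j * x k j 0)))
      (\sum_j opmx T i j * eta j 0).
    apply: ideal_ucvg_sum => // j.
    apply: (series_uniform_ideal_cvg hI hJ JS _ (d4 i j) (d3 i j)).
    - by move=> A n K AAA Sn; exact: rowS.
    - have /bounded_funE[M xM] := bx; apply/bounded_funE; exists M => k.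
      exact: le_trans (norm_coord_le _ _) (xM k).
    - exact: ideal_cvg_coord.
  move=> U /ulim[S' JS' HS']; exists S' => // n A S'n AAA.
  by rewrite (applyE A x AAA bx).2; exact: HS'.
split=> [A AAA|x [bx _] eta xeta]; last exact: lim.
split=> [x [bx _]|x [bx [eta xeta]]]; first exact: (applyE A x AAA bx).1.
split; last by exists (T eta); exact: (ideal_ucvg_cvg hJ AAA (lim x eta bx xeta)).
have [M xM] := (bounded_funE x).1 bx; have [C' HC'] := rowC A AAA.
(* Absolute values make this constant visibly nonnegative, as the maximum norm estimate requires. *)
apply/bounded_funE; exists (\sum_(j < d) `|C' * M|) => n.
apply: norm_col_le => [|i]; first exact: sumr_ge0.
rewrite (applyE A x AAA bx).2; apply: le_trans (ler_norm_sum _ _ _) _.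
apply: ler_sum => j _; apply: le_trans _ (ler_norm _).
apply: (series_mul_bounded (HC' n i j) _).2 => k.
exact: le_trans (norm_coord_le _ _) (xM k).
Qed.

Theorem theorem2p4 (R : realType) (d m : nat) (hd : (1 <= d)%N) (hm : (1 <= m)%N)
  (AA : set (op_matrix 'cV[R]_d 'cV[R]_m)) (T : {linear 'cV[R]_d -> 'cV[R]_m})
  (I J : set (set nat))
  (AA_nonempty : AA !=set0)
  (AA_bounded : forall A, AA A -> forall n k, bounded_op (A n k))
  (T_bounded : bounded_op T)
  (I_ideal : is_ideal I) (J_ideal : is_ideal J)
  (J_cg : countably_generated J) :
  regular I J AA T <->
  [/\ (* (D1) *)
      forall A, AA A ->
        (ereal_sup [set abs_row_sum A n | n in [set: nat]] < +oo)%E,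
      (* (D2) *)
      exists2 J0, ideal_dual J J0 &
        (ereal_sup [set ereal_sup [set abs_row_sum A n | n in J0] | A in AA]
           < +oo)%E,
      (* (D3) *)
      forall (i : 'I_m) (j : 'I_d),
        ideal_ucvg J AA
          (fun A n => \big[+%R/0]_(0 <= k <oo) opmx (A n k) i j) (opmx T i j)
    & (* (D4) *)
      forall (i : 'I_m) (j : 'I_d) (E : set nat), I E ->
        ideal_ucvg J AA
          (fun A n => \big[+%R/0]_(0 <= k <oo | k \in E) opmx (A n k) i j) 0].
Proof.
have d4E i j (E : set nat) : (fun A : op_matrix 'cV[R]_d 'cV[R]_m => fun n =>
      \big[+%R/0]_(0 <= k <oo | k \in E) opmx (A n k) i j) =
    (fun A n => limn (series (fun k => opmx (A n k) i j * \1_E k))).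
  by apply/funext => A; apply/funext => n; exact: lim_sum_mem.
split=> [reg|[d1 [S JS d2] d3 d4]]; last first.
  have [C HC] := ereal_sup_lty d2.
  apply: (@absolute_rows_regular _ _ _ _ _ _ _ S C) => //.
  - move=> A /d1/ereal_sup_lty[C' HC']; exists C' => n i j K.
    by apply: le_abs_row_sum; apply: HC'; exists n.
  - move=> A n i j K AAA Sn; apply: le_abs_row_sum.
    apply: le_trans (HC _ (ex_intro2 _ _ A AAA erefl)).
    by apply: ereal_sup_ubound; exists n.
  - by move=> i j E IE; rewrite -d4E; exact: d4.
split.
- move=> A AAA.
  (* One constant per entry; their finite sum bounds the full row sums. *)
  have /choice[C HC] (ij : 'I_m * 'I_d) : exists C, forall n K,
      \sum_(0 <= k < K) `|opmx (A n k) ij.1 ij.2| <= C.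
    exact: (regular_rows_bounded _ _ I_ideal J_ideal reg AAA).
  apply: (@ereal_sup_le_lty _ _ (\sum_i \sum_j C (i, j))) => _ [n _ <-].
  by apply: abs_row_sum_le => i j K; exact: (HC (i, j)).
- have /choice[S HS] (ij : 'I_m * 'I_d) :=
    regular_rows_ubounded ij.1 ij.2 I_ideal J_ideal J_cg reg.
  have /choice[C HC] := HS.
  exists [set n | forall ij, S ij n].
    by apply: ideal_dual_bigcap => // ij; exact: (HC ij).1.
  apply: (@ereal_sup_le_lty _ _ (\sum_i \sum_j C (i, j))) => _ [A AAA <-].
  apply: ge_ereal_sup => _ [n Sn <-].
  by apply: abs_row_sum_le => i j K; exact: (HC (i, j)).2.
- move=> i j.
  (* The constant sequence 1, written as an indicator, tests the plain row sums. *)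
  have b1 : bounded_fun (\1_setT : nat -> R) by exact: bounded_indic.
  have cvg1 : ideal_cvg I (\1_setT : nat -> R) 1.
    by apply: cvg_ideal_cvg => //; rewrite indicT; exact: cvg_cst.
  have [_ _] := regular_entry i j J_ideal reg b1 cvg1.
  rewrite mulr1 => h U /h[S JS HS]; exists S => // n A Sn AAA.
  have := HS n A Sn AAA; congr (U (limn (series _))).
  by apply/funext => k; rewrite indicT mulr1.
- move=> i j E IE; rewrite d4E.
  have [_ _] := regular_entry i j J_ideal reg (bounded_indic R E)
    (indic_ideal_cvg0 I_ideal IE).
  by rewrite mulr0.
Qed.
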